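(* Let $f:\mathbb{R}^n\to\mathbb{R}\cup\{+\infty\}$ be three times continuously differentiable on $\mathrm{dom}(f)$, bounded below, and $F$-based $\kappa$-self-concordant with respect to a convex function $F:\mathbb{R}^n\to\mathbb{R}\cup\{+\infty\}$, for some $\kappa>0$. Suppose that $f+F$ is $\alpha$-strongly convex for some $\alpha>0$. Let $x^\star$ be an optimal solution (minimizer) of $\min_{x\in\mathbb{R}^n}f(x)$ and suppose that $f$ satisfies the Polyak–Łojasiewicz condition with constant $\mu>0$ in a neighborhood $U\subseteq\mathrm{dom}(f)$ of $x^\star$, i.e. $\frac12\|\nabla f(x)\|^2\ge\mu\,(f(x)-f(x^\star))$ for all $x\in U$. Let $\{x_j\}_{j\ge0}$ be generated by the Regularized Newton's Method (RNM) from some $x_0\in\mathrm{dom}(f)$. If $x^\star$ is a limit point of $\{x_j\}_{j\ge0}$, then $x_j\to x^\star$, and $f(x_j)-f(x^\star)$ converges $Q$-linearly to $0$.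
   Context: Notation: $\mathrm{dom}(f)=\{x\in\mathbb{R}^n: f(x)<+\infty\}$; $\nabla^2 f(x)[h,h]=h^\top\nabla^2 f(x)h$, and $\nabla^3 f(x)[h,h,h]$ is the third directional derivative of $f$ at $x$ along $h$. $\|\cdot\|$ is the Euclidean norm. A limit point of a sequence is a limit of some subsequence. For $\kappa>0$, a closed convex function $g:\mathbb{R}^n\to\mathbb{R}\cup\{+\infty\}$ is $\kappa$-self-concordant if $\mathrm{dom}(g)$ is open, $g$ is three times continuously differentiable on $\mathrm{dom}(g)$, and $\nabla^3 g(x)[h,h,h]\le 2\kappa(\nabla^2 g(x)[h,h])^{3/2}$ for all $x\in\mathrm{dom}(g)$, $h\in\mathbb{R}^n$. Given $F:\mathbb{R}^n\to\mathbb{R}\cup\{+\infty\}$, the function $f$ is $F$-based $\kappa$-self-concordant if $\mathrm{dom}(f)\subseteq\mathrm{dom}(F)$, $g=f+F$ is $\kappa$-self-concordant, and $\nabla^2 g(x)\succ0$ for all $x\in\mathrm{dom}(f)$. RNM: starting from $x_0\in\mathrm{dom}(f)$, for $j=0,1,2,\dots$ set $d_j=-(\nabla^2(f+F)(x_j))^{-1}\nabla f(x_j)$, $\lambda_j=\sqrt{-\nabla f(x_j)^\top d_j}$, $t_j=\frac{1}{1+\kappa\lambda_j}$, $x_{j+1}=x_j+t_jd_j$. A nonnegative sequence $a_j$ converges $Q$-linearly to $0$ if there are $q\in(0,1)$ and $K\in\mathbb{N}$ such that $a_{j+1}\le q\,a_j$ for all $j\ge K$. *)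

(* Defs.v *)
From HB Require Import structures.
From mathcomp Require Import all_boot all_order all_algebra.
From mathcomp Require Import all_classical all_reals all_analysis.

Set Implicit Arguments.
Unset Strict Implicit.
Unset Printing Implicit Defensive.

Import Order.TTheory GRing.Theory Num.Theory.
Import numFieldNormedType.Exports.

Local Open Scope classical_set_scope.
Local Open Scope ring_scope.

Section Euclidean.
Context {R : realType} {n : nat}.
Implicit Types (u v x y h : 'cV[R]_n).

Definition dotv u v : R := (u^T *m v) 0 0.

(* The library norm `|u| on 'cV[R]_n is the sup norm (same topology). *)
Definition norm2 u : R := Num.sqrt (\sum_i u i 0 ^+ 2).

Definition quad_form (A : 'M[R]_n) h : R := (h^T *m A *m h) 0 0.

(* Used for Hessians of C^2 functions, which are symmetric. *)
Definition posdef (A : 'M[R]_n) : Prop := forall h, h != 0 -> 0 < quad_form A h.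

End Euclidean.

Section Smooth.
Context {R : realType} {n : nat}.
Implicit Types (f : 'cV[R]_n -> R) (D : set 'cV[R]_n).

Definition gradient f (x : 'cV[R]_n) : 'cV[R]_n :=
  \col_i 'D_(delta_mx i 0) f x.

Definition hessian f (x : 'cV[R]_n) : 'M[R]_n :=
  \matrix_(i, j) 'D_(delta_mx i 0) ('D_(delta_mx j 0) f) x.

Definition third_dir f (x h : 'cV[R]_n) : R := 'D_h ('D_h ('D_h f)) x.

(* k times continuously differentiable on D; meant for open D. *)
Fixpoint continuously_diff (k : nat) D f : Prop :=
  match k with
  | 0 => forall x, D x -> {for x, continuous f}
  | k'.+1 => (forall x, D x -> differentiable f x) /\
             (forall v, continuously_diff k' D ('D_v f))
  end.

End Smooth.

(* Extended-valued functions R^n -> R \cup {+oo} are functions into \bar R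
   that never take the value -oo; derivatives are those of [fine \o f], and
   are only meaningful on the (open) domain. *)
Section ExtendedFunctions.
Context {R : realType} {n : nat}.
Implicit Types (f F g : 'cV[R]_n -> \bar R).

Definition never_ninfty f : Prop := forall x, (-oo < f x)%E.

Definition dom f : set 'cV[R]_n := [set x | (f x < +oo)%E].

Definition toR f : 'cV[R]_n -> R := fun x => fine (f x).

Definition esum_fun f F : 'cV[R]_n -> \bar R := fun x => (f x + F x)%E.

Definition bounded_below f : Prop := exists m : R, forall x, (m%:E <= f x)%E.

Definition minimizer f (xstar : 'cV[R]_n) : Prop :=
  forall x, (f xstar <= f x)%E.

Definition econvex f : Prop :=
  forall (x y : 'cV[R]_n) (t : R), 0 < t < 1 ->
    (f (t *: x + (1 - t) *: y)%R <= t%:E * f x + (1 - t)%R%:E * f y)%E.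

Definition strongly_convex (alpha : R) f : Prop :=
  forall (x y : 'cV[R]_n) (t : R), 0 < t < 1 ->
    (f (t *: x + (1 - t) *: y)%R <=
       t%:E * f x + (1 - t)%R%:E * f y
       - (alpha / 2 * t * (1 - t) * norm2 (x - y) ^+ 2)%R%:E)%E.

Definition epigraph f : set ('cV[R]_n * R) :=
  [set p | (f p.1 <= p.2%:E)%E].

Definition self_concordant (kappa : R) g : Prop :=
  [/\ never_ninfty g /\ econvex g,
      closed (epigraph g),
      open (dom g),
      continuously_diff 3 (dom g) (toR g)
    & forall x h, dom g x ->
        third_dir (toR g) x h <=
        2 * kappa * (quad_form (hessian (toR g) x) h `^ (3 / 2))].

Definition based_self_concordant F (kappa : R) f : Prop :=
  [/\ dom f `<=` dom F,
      self_concordant kappa (esum_fun f F)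
    & forall x, dom f x -> posdef (hessian (toR (esum_fun f F)) x)].

Definition PL_on (mu : R) f (xstar : 'cV[R]_n) (U : set 'cV[R]_n) : Prop :=
  forall x, U x ->
    mu * (toR f x - toR f xstar) <= 1 / 2 * norm2 (gradient (toR f) x) ^+ 2.

End ExtendedFunctions.

Section RNM.
Context {R : realType} {n : nat}.
Variables (kappa : R) (f F : 'cV[R]_n -> \bar R).
Implicit Types x : 'cV[R]_n.

Definition RNM_dir x : 'cV[R]_n :=
  - (invmx (hessian (toR (esum_fun f F)) x) *m gradient (toR f) x).

Definition RNM_lambda x : R :=
  Num.sqrt (- dotv (gradient (toR f) x) (RNM_dir x)).

Definition RNM_step x : R := 1 / (1 + kappa * RNM_lambda x).

Definition RNM_sequence (xs : nat -> 'cV[R]_n) : Prop :=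
  dom f (xs 0%N) /\
  forall j, xs j.+1 = xs j + RNM_step (xs j) *: RNM_dir (xs j).

End RNM.

Section Sequences.
Context {R : realType}.

Definition limit_of_subseq (T : topologicalType) (xs : nat -> T) (l : T) : Prop :=
  exists2 phi : nat -> nat,
    {homo phi : i j / (i < j)%N} & (xs \o phi) @ \oo --> l.

Definition Q_linear_to0 (a : nat -> R) : Prop :=
  (forall j, 0 <= a j) /\
  exists (q : R) (K : nat),
    0 < q < 1 /\ forall j, (K <= j)%N -> a j.+1 <= q * a j.

End Sequences.

(* Main.v *)
Require Import Defs.
From HB Require Import structures.
From mathcomp Require Import all_boot all_order all_algebra.
From mathcomp Require Import all_classical all_reals all_analysis.
From mathcomp Require Import ring lra.

Set Implicit Arguments.
Unset Strict Implicit.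
Unset Printing Implicit Defensive.

Import Order.TTheory GRing.Theory Num.Theory.
Import numFieldNormedType.Exports.

Local Open Scope classical_set_scope.
Local Open Scope ring_scope.

(** Write [g = f + F], [H] for its Hessian, [d] for the Newton-type direction
    at [x], [l] for the decrement and [t = 1 / (1 + kappa l)], so that
    [H d = - grad f] and [l ^ 2 = d^T H d].

    A step never leaves the domain.  Along the line [x + s d], self-concordance
    says that [(d^T H d)^(-1/2)] has slope at least [- kappa]; hence for
    [s <= t] the second derivative stays below [l ^ 2 (1 + kappa l) ^ 2] as long
    as the segment is in the domain ([self_concordant_growth]).  So [g] stays
    bounded there, and since its epigraph is closed while its domain is open,
    the segment cannot exit ([self_concordant_step_dom]).

    A step decreases [f] when [l] is small.  The second-order bound on [g]
    gives [g (x + t d) <= g x + t grad g . d + l ^ 2 / 2], and convexity of [F]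
    lets [f] inherit the bound with [grad f] instead of [grad g]
    ([based_model_le]), so that
    [f (x + t d) <= f x - l ^ 2 (t - 1 / 2)] ([RNM_descent]).

    Near [xstar] the gradient of [f] is small, hence so is [l] and [t - 1 / 2]
    is at least [1 / 6]; the Hessian is bounded, so
    [l ^ 2] dominates [|grad f| ^ 2], which by the Polyak-Lojasiewicz
    inequality dominates the gap [f x - f xstar].  Thus the gap contracts by a
    fixed factor.  Strong convexity bounds the step by a multiple of [l],
    and [l ^ 2 / 6] is at most the gap, so a step has length
    [O (sqrt (f x - f xstar))] ([RNM_local_contraction]).

    Since square roots of the gaps then decay geometrically, the steps that
    remain have total length controlled by the current gap: once an iterate is
    close enough to [xstar] with a small enough gap, which happens along the
    given subsequence, the iterates are trapped near [xstar]
    ([contracting_sequence_cvg]). *)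

(** * One-variable calculus *)

Section OneVariable.
Context {R : realType}.
Implicit Types (p q : R -> R) (T M kappa : R).

Lemma is_derive_segment_continuous p p1 T :
  (forall t, 0 <= t <= T -> is_derive t 1 p (p1 t)) ->
  {within `[0, T], continuous p}.
Proof.
move=> dp; apply: derivable_within_continuous => t; rewrite in_itv /= => t0T.
by have := dp t t0T => -[].
Qed.

Lemma le_of_derive_le p p1 c T : 0 <= T ->
  (forall t, 0 <= t <= T -> is_derive t 1 p (p1 t)) ->
  (forall t, 0 <= t <= T -> p1 t <= c) ->
  p T <= p 0 + c * T.
Proof.
move=> T0 dp p1c; have cp := is_derive_segment_continuous dp.
have [t|t] := @MVT_segment _ p p1 _ _ T0 _ cp.
  by rewrite in_itv /= => /andP[/ltW ? /ltW ?]; apply: dp; apply/andP.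
rewrite in_itv /= subr0 => t0T pT.
by rewrite -lerBlDl pT ler_wpM2r // p1c.
Qed.

Lemma taylor2_le p p1 p2 M T : 0 <= T ->
  (forall t, 0 <= t <= T -> is_derive t 1 p (p1 t)) ->
  (forall t, 0 <= t <= T -> is_derive t 1 p1 (p2 t)) ->
  (forall t, 0 <= t <= T -> p2 t <= M) ->
  p T <= p 0 + p1 0 * T + M / 2 * T ^+ 2.
Proof.
move=> T0 dp dp1 p2M.
have p1M t : 0 <= t <= T -> p1 t <= p1 0 + M * t.
  move=> /andP[t0 tT]; apply: (le_of_derive_le (p1 := p2)) => // s /andP[s0 st].
    by apply: dp1; rewrite s0 (le_trans st).
  by apply: p2M; rewrite s0 (le_trans st).
pose h : R -> R := fun t => p t - (M / 2) * t ^+ 2.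
have dh t : 0 <= t <= T -> is_derive t 1 h (p1 t - M * t).
  move=> /dp dpt; rewrite /h.
  have -> : (fun t => p t - (M / 2) * t ^+ 2) = p - (M / 2) *: ((@GRing.exp R)^~ 2%N).
    by apply/funext.
  apply: is_derive_eq.
  by rewrite !scaler1 /GRing.scale /=; lra.
have := le_of_derive_le (c := p1 0) T0 dh.
rewrite /h expr0n /= mulr0 subr0 => H.
have {}H : p T - M / 2 * T ^+ 2 <= p 0 + p1 0 * T.
  by apply: H => t /p1M; rewrite lerBlDr.
by move: H; rewrite lerBlDr.
Qed.

Lemma powR32 (a : R) : 0 < a -> a `^ (3 / 2) = a * Num.sqrt a.
Proof.
move=> a0; have -> : 3 / 2 = 1 + 2^-1 :> R by lra.
by rewrite powRD ?powR12_sqrt ?powRr1 ?ltW // gt_eqF // implybT.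
Qed.

(** The inequality says that [(p2)^(-1/2)] has derivative at least [- kappa], so
    [p2 T ^ (-1/2) >= p2 0 ^ (-1/2) - kappa T]; the constraint on [T] keeps the
    right-hand side at least [(l (1 + kappa l))^-1], where [l = sqrt (p2 0)]. *)
Lemma self_concordant_growth p2 p3 kappa T :
  0 < kappa -> 0 <= T -> T * (1 + kappa * Num.sqrt (p2 0)) <= 1 ->
  (forall t, 0 <= t <= T -> is_derive t 1 p2 (p3 t)) ->
  (forall t, 0 <= t <= T -> 0 < p2 t) ->
  (forall t, 0 <= t <= T -> p3 t <= 2 * kappa * (p2 t `^ (3 / 2))) ->
  p2 T <= p2 0 * (1 + kappa * Num.sqrt (p2 0)) ^+ 2.
Proof.
move=> k0 T0 Tl dp2 p20 p3le.
pose s t := Num.sqrt (p2 t).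
have s0 t : 0 <= t <= T -> 0 < s t by move=> /p20; rewrite sqrtr_gt0.
(* The sign makes the lower bound on the slope an upper one. *)
pose v t := - (s t)^-1.
have dv t : 0 <= t <= T ->
    is_derive t 1 v (- (- (s t) ^- 2 *: ((2 * s t)^-1 * p3 t))).
  move=> tT; rewrite /v.
  have ds : is_derive t 1 s ((2 * s t)^-1 * p3 t).
    by apply: is_derive1_comp; [exact: is_derive1_sqrt (p20 _ tT)|exact: dp2].
  apply: is_deriveN; apply: is_deriveV => //.
  by rewrite gt_eqF ?s0.
have T00 : 0 <= T <= T by rewrite T0 /=.
have T0T : (0 : R) <= 0 <= T by rewrite lexx.
have : v T <= v 0 + kappa * T.
  apply: (le_of_derive_le T0 dv) => t tT.
  have st := s0 _ tT.
  have e : p2 t = s t ^+ 2 by rewrite sqr_sqrtr // ltW // p20.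
  have := p3le _ tT; rewrite powR32 ?p20 // -/(s t) e => h.
  rewrite /GRing.scale /= mulNr opprK mulrA -invfM mulrC.
  rewrite ler_pdivrMr ?mulr_gt0 ?exprn_gt0 //.
  by apply: (le_trans h); rewrite le_eqVlt; apply/orP; left; apply/eqP; ring.
rewrite /v -lerN2 opprK opprD opprK => h.
have l0 := s0 _ T0T; have lT := s0 _ T00.
rewrite -/(s 0) in Tl *; set l := s 0 in h l0 Tl *.
have kl : 0 < 1 + kappa * l by rewrite addr_gt0 // mulr_gt0.
have e0 : p2 0 = l ^+ 2 by rewrite sqr_sqrtr // ltW // p20.
have eT : p2 T = s T ^+ 2 by rewrite sqr_sqrtr // ltW // p20.
have {}h : (l * (1 + kappa * l))^-1 <= (s T)^-1.
  apply: le_trans h; rewrite -(ler_pM2l (mulr_gt0 l0 kl)) divff ?gt_eqF ?mulr_gt0 //.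
  have -> : l * (1 + kappa * l) * (l^-1 - kappa * T) =
      (l / l) * (1 + kappa * l) - kappa * l * (T * (1 + kappa * l)) by ring.
  rewrite divff ?gt_eqF // mul1r lerBrDr lerD2l.
  by rewrite ger_pMr // mulr_gt0.
have ll : 0 < l * (1 + kappa * l) by rewrite mulr_gt0.
rewrite e0 eT -exprMn ler_pXn2r ?nnegrE ?(ltW ll) ?(ltW lT) //.
by rewrite -lef_pV2 ?posrE ?mulr_gt0.
Qed.

(** The chord inequality from [0] bounds every difference quotient at [0+] by
    [p 1 - p 0]. *)
Lemma convex_derive_le p (c : R) :
  is_derive (0 : R) 1 p c ->
  (forall s, 0 < s < 1 -> p s <= (1 - s) * p 0 + s * p 1) ->
  c <= p 1 - p 0.
Proof.
move=> dp pconv.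
have [/cvg_ex[l /= pl] <-] := dp.
rewrite /derive (cvg_lim _ pl) //.
have := cvg_dnbhs_at_right pl.
move/cvgr_to_le; apply; near=> s.
have s0 : 0 < s by [].
have s1 : s < 1 by near: s; apply: nbhs_right_lt.
rewrite /= addr0 [s%:A]mulr1 /GRing.scale /= -(ler_pM2l s0) mulrA divff ?gt_eqF // mul1r.
by have := pconv s; rewrite s0 s1 => /(_ isT); lra.
Unshelve. all: by end_near. Qed.

End OneVariable.

(** * Derivatives along lines *)

Section Lines.
Context {R : realType} {n : nat}.
Implicit Types (g : 'cV[R]_n -> R) (D : set 'cV[R]_n) (x h d : 'cV[R]_n).

Lemma near_line x h (A : set 'cV[R]_n) : nbhs x A ->
  nbhs (0 : R) ((fun t => x + t *: h) @^-1` A).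
Proof.
move=> xA; have e : x + 0 *: h = x by rewrite scale0r addr0.
have : x + t *: h @[t --> (0 : R)] --> x.
  by rewrite -[X in _ --> X]e; apply: cvgD; [exact: cvg_cst|apply: cvgZr_tmp].
by apply.
Qed.

Lemma is_derive_line g x h (t : R) : derivable g (x + t *: h) h ->
  is_derive t 1 (fun s => g (x + s *: h)) ('D_h g (x + t *: h)).
Proof.
rewrite /derive => dg.
have e : (fun s : R => s^-1 *: (((fun s => g (x + s *: h)) \o shift t) (s *: (1 : R))
             - g (x + t *: h)))
    = (fun s => s^-1 *: ((g \o shift (x + t *: h)) (s *: h) - g (x + t *: h))).
  by apply/funext => s /=; rewrite [s%:A]mulr1 scalerDl addrCA.
by apply: DeriveDef; rewrite /derivable /derive e.
Qed.

Lemma derive_dotv g x h : differentiable g x ->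
  'D_h g x = dotv (gradient g x) h.
Proof.
move=> dg; rewrite deriveE // {1}(matrix_sum_delta h) linear_sum /=.
rewrite /dotv mxE; apply: eq_bigr => i _.
by rewrite big_ord1 linearZ /= !mxE deriveE // mulrC.
Qed.

(** The identity [derive_dotv] holds on a whole neighborhood of [x] because [D]
    is open, so it may be differentiated once more. *)
Lemma derive2_quad_form g D x h : open D -> continuously_diff 3 D g -> D x ->
  'D_h ('D_h g) x = quad_form (hessian g x) h.
Proof.
move=> oD [dg cdg] Dx.
have ddg v : differentiable ('D_v g) x by have [dvg _] := cdg v; apply: dvg.
rewrite (near_eq_derive (g := \sum_j h j 0 *: 'D_(delta_mx j 0) g)); last first.
  have : nbhs x D by apply: open_nbhs_nbhs.
  apply: filterS => y /dg dgy; rewrite derive_dotv // /dotv mxE fct_sumE.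
  by apply: eq_bigr => i _; rewrite !mxE mulrC.
rewrite derive_sum; last by move=> i; apply/derivableZ/diff_derivable.
rewrite /quad_form mxE; apply: eq_bigr => j _.
rewrite deriveZ; last exact: diff_derivable.
rewrite derive_dotv // /GRing.scale /= mulrC; congr (_ * _).
by rewrite /dotv !mxE; apply: eq_bigr => i _; rewrite !mxE mulrC.
Qed.

Lemma taylor2_line_le g D x h (M T : R) : continuously_diff 3 D g -> 0 <= T ->
  (forall t, 0 <= t <= T -> D (x + t *: h)) ->
  (forall t, 0 <= t <= T -> 'D_h ('D_h g) (x + t *: h) <= M) ->
  g (x + T *: h) <= g x + 'D_h g x * T + M / 2 * T ^+ 2.
Proof.
move=> [dg /(_ h)[ddg _]] T0 Dxh leM.
have d1 t : 0 <= t <= T ->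
    is_derive t 1 (fun s => g (x + s *: h)) ('D_h g (x + t *: h)).
  by move=> /Dxh Dt; apply: is_derive_line; apply: diff_derivable; apply: dg.
have d2 t : 0 <= t <= T ->
    is_derive t 1 (fun s => 'D_h g (x + s *: h)) ('D_h ('D_h g) (x + t *: h)).
  by move=> /Dxh Dt; apply: is_derive_line; apply: diff_derivable; apply: ddg.
by have := taylor2_le T0 d1 d2 leM; rewrite /= scale0r addr0.
Qed.

End Lines.

(** * Extended-valued convex functions *)

Section Extended.
Context {R : realType} {n : nat}.
Implicit Types (f F g : 'cV[R]_n -> \bar R) (x y h d : 'cV[R]_n).

Lemma toRK f x : never_ninfty f -> dom f x -> f x = (toR f x)%:E.
Proof.
move=> nf fx; rewrite /toR fineK // fin_numE; apply/andP; split; first by rewrite gt_eqF ?nf.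
by rewrite lt_eqF // fx.
Qed.

Lemma econvex_toR f x y t : never_ninfty f -> econvex f -> dom f x -> dom f y ->
  0 < t < 1 -> dom f (t *: x + (1 - t) *: y) /\
  toR f (t *: x + (1 - t) *: y) <= t * toR f x + (1 - t) * toR f y.
Proof.
move=> nf cf fx fy t01; have := cf x y t t01.
rewrite (toRK nf fx) (toRK nf fy) -!EFinM -EFinD => h.
have fz : dom f (t *: x + (1 - t) *: y) by apply: le_lt_trans h _; rewrite ltry.
by split => //; move: h; rewrite (toRK nf fz) lee_fin.
Qed.

Lemma dom_segment f x h T t : never_ninfty f -> econvex f ->
  dom f x -> dom f (x + T *: h) -> 0 <= t <= T -> dom f (x + t *: h).
Proof.
move=> nf cf fx fT /andP[t0 tT].
have [->|t_neq0] := eqVneq t 0; first by rewrite scale0r addr0.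
have [->//|t_neqT] := eqVneq t T.
have {}t0 : 0 < t by rewrite lt_def t_neq0.
have {}tT : t < T by rewrite lt_neqAle t_neqT.
have T0 : 0 < T := lt_trans t0 tT.
have s01 : 0 < t / T < 1 by rewrite divr_gt0 //= ltr_pdivrMr ?mul1r.
have [+ _] := econvex_toR nf cf fT fx s01.
suff -> : t / T *: (x + T *: h) + (1 - t / T) *: x = x + t *: h by [].
rewrite scalerDr scalerA divfK ?gt_eqF // scalerBl scale1r.
by rewrite addrAC addrCA subrr addr0.
Qed.

Lemma dom_esum f F : never_ninfty f -> never_ninfty F -> dom f `<=` dom F ->
  dom (esum_fun f F) = dom f.
Proof.
move=> nf nF fF; apply/seteqP; split=> x; rewrite /dom /esum_fun /=.
  by case: (f x) (F x) (nF x) => [a||] [b||] //=; rewrite ?ltry.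
by move=> fx; apply: lte_add_pinfty => //; exact: fF.
Qed.

Lemma toR_esum f F x : never_ninfty f -> never_ninfty F -> dom f x -> dom F x ->
  toR (esum_fun f F) x = toR f x + toR F x.
Proof. by move=> nf nF fx Fx; rewrite {1}/toR /esum_fun (toRK nf fx) (toRK nF Fx). Qed.

End Extended.

(** * Self-concordance *)

Lemma quad_form0 (R : realType) n (A : 'M[R]_n) : quad_form A 0 = 0.
Proof. by rewrite /quad_form mulmx0 mxE. Qed.

Lemma quad_formN (R : realType) n (A : 'M[R]_n) h : quad_form A (- h) = quad_form A h.
Proof.
have e : (- h)^T = - h^T by apply/matrixP => i j; rewrite !mxE.
by rewrite /quad_form e mulmxN !mulNmx opprK.
Qed.

Lemma norm2_sqr (R : realType) n (h : 'cV[R]_n) : norm2 h ^+ 2 = \sum_i h i 0 ^+ 2.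
Proof. by rewrite sqr_sqrtr // sumr_ge0 // => i _; exact: sqr_ge0. Qed.

Lemma norm2Z_sqr (R : realType) n (a : R) (h : 'cV[R]_n) :
  norm2 (a *: h) ^+ 2 = a ^+ 2 * norm2 h ^+ 2.
Proof.
by rewrite !norm2_sqr mulr_sumr; apply: eq_bigr => i _; rewrite mxE exprMn.
Qed.

Section SelfConcordance.
Context {R : realType} {n : nat}.
Variables (g : 'cV[R]_n -> \bar R) (kappa : R).
Hypothesis kappa_gt0 : 0 < kappa.
Hypothesis g_sc : self_concordant kappa g.
Hypothesis g_posdef : forall x, dom g x -> posdef (hessian (toR g) x).
Implicit Types x h d : 'cV[R]_n.

Let q x h := quad_form (hessian (toR g) x) h.

Lemma self_concordant_hessian_le x h T : dom g x -> dom g (x + T *: h) ->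
  0 <= T -> T * (1 + kappa * Num.sqrt (q x h)) <= 1 ->
  q (x + T *: h) h <= q x h * (1 + kappa * Num.sqrt (q x h)) ^+ 2.
Proof.
have [[ng cg] _ og [dg cdg] sc] := g_sc.
move=> gx gT T0 Tle.
have [h0|h0] := eqVneq h 0.
  have e y : q y h = 0 by rewrite h0; exact: quad_form0.
  by rewrite (e (_ + _)) (e x) mul0r.
have gt t : 0 <= t <= T -> dom g (x + t *: h) by exact: dom_segment.
have D2 y : dom g y -> 'D_h ('D_h (toR g)) y = q y h.
  by move=> gy; apply: (derive2_quad_form h og _ gy).
pose p2 t := 'D_h ('D_h (toR g)) (x + t *: h).
have p2E t : dom g (x + t *: h) -> p2 t = q (x + t *: h) h by exact: D2.
have p20 : p2 0 = q x h by rewrite p2E scale0r addr0.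
have dp2 t : 0 <= t <= T -> is_derive t 1 p2 (third_dir (toR g) (x + t *: h) h).
  move=> /gt gxt; apply: is_derive_line; apply: diff_derivable.
  by have [_ /(_ h)[H _]] := cdg h; apply: H.
have p2_gt0 t : 0 <= t <= T -> 0 < p2 t.
  by move=> /gt gxt; rewrite p2E //; exact: g_posdef.
have p3_le t : 0 <= t <= T ->
    third_dir (toR g) (x + t *: h) h <= 2 * kappa * (p2 t `^ (3 / 2)).
  by move=> /gt gxt; rewrite p2E //; exact: sc.
rewrite -p20 in Tle *; rewrite -p2E //.
exact: self_concordant_growth kappa_gt0 T0 Tle dp2 p2_gt0 p3_le.
Qed.

Lemma self_concordant_upper x h T : dom g x -> dom g (x + T *: h) ->
  0 <= T -> T * (1 + kappa * Num.sqrt (q x h)) <= 1 ->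
  toR g (x + T *: h) <= toR g x + 'D_h (toR g) x * T +
    q x h * (1 + kappa * Num.sqrt (q x h)) ^+ 2 / 2 * T ^+ 2.
Proof.
have [[ng cg] _ og cdg _] := g_sc.
move=> gx gT T0 Tle.
have gt t : 0 <= t <= T -> dom g (x + t *: h) by exact: dom_segment.
apply: (taylor2_line_le cdg T0 gt) => t /andP[t0 tT].
have gxt : dom g (x + t *: h) by apply: gt; rewrite t0.
rewrite (derive2_quad_form _ og cdg gxt).
apply: self_concordant_hessian_le => //; apply: le_trans Tle.
by rewrite ler_wpM2r // addr_ge0 // mulr_ge0 ?sqrtr_ge0 // ltW.
Qed.

(** This is the inclusion of (part of) the Dikin ellipsoid in the domain.  The set
    of good [t] in [[0, T]] is open because the domain is, and closed because
    it is where [g (x + t h)] is at most the constant [B] given by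
    [self_concordant_upper]; connectedness of [[0, T]] concludes. *)
Lemma self_concordant_step_dom x h T : dom g x -> 0 <= T ->
  T * (1 + kappa * Num.sqrt (q x h)) <= 1 -> dom g (x + T *: h).
Proof.
have [[ng cg] clg og _ _] := g_sc.
move=> gx T0 Tle.
pose B := toR g x + `|'D_h (toR g) x| * T +
  `|q x h * (1 + kappa * Num.sqrt (q x h)) ^+ 2 / 2| * T ^+ 2.
have gB t : 0 <= t <= T -> dom g (x + t *: h) -> toR g (x + t *: h) <= B.
  move=> /andP[t0 tT] gxt; apply: le_trans (self_concordant_upper gx gxt t0 _) _.
    apply: le_trans Tle.
    by rewrite ler_wpM2r // addr_ge0 // mulr_ge0 ?sqrtr_ge0 // ltW.
  rewrite /B -!addrA lerD2l lerD //.
    by apply: le_trans (ler_norm _) _; rewrite normrM (ger0_norm t0) ler_wpM2l.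
  apply: le_trans (ler_norm _) _.
  rewrite normrM (ger0_norm (exprn_ge0 _ t0)) ler_wpM2l //.
  by rewrite ler_pXn2r ?nnegrE.
have line_cont : continuous (fun t : R => x + t *: h).
  by move=> t; apply: cvgD; [exact: cvg_cst|apply: cvgZr_tmp].
pose A := [set t : R | t \in `[0, T] /\ dom g (x + t *: h)].
have AE : A = `[0, T]%classic.
  apply: segment_connected.
  - by exists 0; split; rewrite ?in_itv /= ?lexx // scale0r addr0.
  - exists ((fun t : R => x + t *: h) @^-1` dom g); last first.
      by apply/seteqP; split=> t [].
    by apply: open_comp og => t _; exact: line_cont.
  - exists ((fun t : R => (x + t *: h, B)) @^-1` epigraph g).
      apply: preimage_closed clg => t _.
      have cB : (fun _ : R => B) s @[s --> t] --> B by exact: cvg_cst.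
      exact: (cvg_pair (line_cont t) cB).
    apply/seteqP; split=> t [tT].
      move=> gxt; split=> //; rewrite /epigraph /= (toRK ng gxt) lee_fin.
      by apply: gB => //; move: tT; rewrite in_itv.
    by move=> gxt; split=> //; exact: le_lt_trans gxt (ltry _).
have [] : A T by rewrite AE /= in_itv /= T0 lexx.
by [].
Qed.

(** If the curvature along [h] were below [alpha |h| ^ 2] at [x], it would be so
    nearby by continuity, and the second-order upper bounds along [h] and [- h]
    would contradict strong convexity at the midpoint [x] of
    [x + T h] and [x - T h]. *)
Lemma strongly_convex_hessian_ge alpha x h :
  strongly_convex alpha g -> dom g x -> alpha * norm2 h ^+ 2 <= q x h.
Proof.
have [[ng _] _ og cdg _] := g_sc; have [dg cdg2] := cdg.
move=> sg gx; rewrite leNgt; apply/negP => qlt.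
pose M := (q x h + alpha * norm2 h ^+ 2) / 2.
have qM : q x h < M by rewrite /M; lra.
have Mlt : M < alpha * norm2 h ^+ 2 by rewrite /M; lra.
have nearx : nbhs x (dom g `&` [set y | 'D_h ('D_h (toR g)) y < M]).
  apply: filterI; first exact: open_nbhs_nbhs.
  have D2c : {for x, continuous ('D_h ('D_h (toR g)))}.
    apply: differentiable_continuous.
    by have [_ /(_ h)[H _]] := cdg2 h; apply: H.
  apply: (cvgr_lt _ D2c); rewrite (derive2_quad_form _ og cdg gx).
  exact: qM.
have /nbhs_ballP[e /= e0 be] := near_line h nearx.
have e20 : 0 < e / 2 by rewrite divr_gt0.
have inD t : `|t| <= e / 2 -> dom g (x + t *: h) /\ 'D_h ('D_h (toR g)) (x + t *: h) < M.
  move=> te; apply: be; rewrite /ball /= sub0r normrN.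
  by apply: le_lt_trans te _; lra.
set T := e / 2 in e20 inD.
have inP t : 0 <= t <= T -> `|t| <= T by move=> /andP[t0 tT]; rewrite ger0_norm.
have inN t : 0 <= t <= T -> `|- t| <= T by move=> /inP; rewrite normrN.
have hN t : x + t *: (- h) = x + (- t) *: h by rewrite scalerN -scaleNr.
have H1 : toR g (x + T *: h) <= toR g x + 'D_h (toR g) x * T + M / 2 * T ^+ 2.
  apply: (taylor2_line_le cdg (ltW e20)) => t /inP/inD[gt Mt]; first exact: gt.
  exact: ltW Mt.
have H2 : toR g (x + T *: (- h)) <= toR g x + 'D_(- h) (toR g) x * T + M / 2 * T ^+ 2.
  apply: (taylor2_line_le cdg (ltW e20)) => t /inN/inD[gt Mt].
    by rewrite hN; exact: gt.
  rewrite hN (derive2_quad_form _ og cdg gt) quad_formN.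
  by rewrite -(derive2_quad_form _ og cdg gt); exact: ltW Mt.
have TT : 0 <= T <= T by rewrite lexx (ltW e20).
have [gT _] := inD _ (inP _ TT).
have [gNT _] := inD _ (inN _ TT).
have DN : 'D_(- h) (toR g) x = - 'D_h (toR g) x.
  by rewrite !derive_dotv /dotv ?mulmxN ?mxE //; exact: dg.
have half01 : 0 < (2^-1 : R) < 1 by rewrite invr_gt0 ltr0n invf_lt1 ?ltr1n.
have := sg (x + T *: h) (x + (- T) *: h) 2^-1 half01.
have -> : 2^-1 *: (x + T *: h) + (1 - 2^-1) *: (x + (- T) *: h) = x.
  have -> : 1 - 2^-1 = 2^-1 :> R by lra.
  rewrite -scalerDr addrACA -scalerDl subrr scale0r addr0.
  have half2 : 2^-1 + 2^-1 = 1 :> R by lra.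
  by rewrite scalerDr -scalerDl half2 scale1r.
have -> : x + T *: h - (x + (- T) *: h) = (2 * T) *: h.
  by rewrite opprD addrACA subrr add0r -scaleNr opprK -scalerDl; congr (_ *: _); lra.
rewrite (toRK ng gx) (toRK ng gT) (toRK ng gNT) -!EFinM -EFinN -!EFinD lee_fin.
rewrite norm2Z_sqr => H3; rewrite DN hN in H2.
have : 0 < T ^+ 2 * (alpha * norm2 h ^+ 2 - M).
  by rewrite mulr_gt0 ?exprn_gt0 // subr_gt0.
by move: H1 H2 H3; set N := norm2 h ^+ 2; nra.
Qed.

End SelfConcordance.

(** * Euclidean linear algebra *)

Section LinearAlgebra.
Context {R : realType} {n : nat}.
Implicit Types (u v h : 'cV[R]_n) (A : 'M[R]_n).

Lemma dotvNl u v : dotv (- u) v = - dotv u v.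
Proof.
by rewrite /dotv !mxE -sumrN; apply: eq_bigr => i _; rewrite !mxE mulNr.
Qed.

(** Cauchy-Schwarz, from Lagrange's identity. *)
Lemma dotv_sqr_le u v : dotv u v ^+ 2 <= norm2 u ^+ 2 * norm2 v ^+ 2.
Proof.
have dotE : dotv u v = \sum_i u i 0 * v i 0.
  by rewrite /dotv mxE; apply: eq_bigr => i _; rewrite mxE.
rewrite dotE !norm2_sqr.
have : 0 <= \sum_i \sum_j (u i 0 * v j 0 - u j 0 * v i 0) ^+ 2.
  by apply: sumr_ge0 => i _; apply: sumr_ge0 => j _; exact: sqr_ge0.
have -> : \sum_i \sum_j (u i 0 * v j 0 - u j 0 * v i 0) ^+ 2 =
    (\sum_i u i 0 ^+ 2) * (\sum_i v i 0 ^+ 2)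
    + (\sum_i v i 0 ^+ 2) * (\sum_i u i 0 ^+ 2)
    - 2 * (\sum_i u i 0 * v i 0) ^+ 2.
  rewrite expr2 !big_distrlr /= mulr_sumr -sumrN -!big_split /=.
  apply: eq_bigr => i _; rewrite mulr_sumr -sumrN -!big_split /=.
  by apply: eq_bigr => j _; ring.
by lra.
Qed.

Lemma norm2_mulmx_sqr_le A h :
  norm2 (A *m h) ^+ 2 <= (\sum_i \sum_j A i j ^+ 2) * norm2 h ^+ 2.
Proof.
rewrite [leLHS]norm2_sqr mulr_suml; apply: ler_sum => i _.
have -> : (A *m h) i 0 = dotv (row i A)^T h.
  by rewrite /dotv trmxK mxE mxE; apply: eq_bigr => j _; rewrite mxE.
have := dotv_sqr_le (row i A)^T h.
by rewrite [X in _ <= X * _ -> _]norm2_sqr; under eq_bigr do rewrite !mxE.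
Qed.

Lemma normr_le_norm2 h : `|h| <= norm2 h.
Proof.
rewrite /Num.norm /= mx_normrE; apply: bigmax_le; first exact: sqrtr_ge0.
move=> [i j] _ /=; rewrite (ord1 j) -sqrtr_sqr ler_wsqrtr //.
by rewrite (bigD1 i) //= lerDl sumr_ge0 // => k _; exact: sqr_ge0.
Qed.

Lemma posdef_unitmx A : posdef A -> A \in unitmx.
Proof.
move=> Apos; rewrite -row_free_unit -kermx_eq0; apply/eqP/row_matrixP => i.
rewrite row0; set w := row i _.
have wA : w *m A = 0 by rewrite /w -row_mul mulmx_ker row0.
apply/eqP; apply/negP => /negP w0.
have /Apos : w^T != 0 by rewrite -[0]trmx0 (inj_eq trmx_inj).
by rewrite /quad_form trmxK wA mul0mx mxE ltxx.
Qed.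

Lemma posdef_quad_form_ge0 A h : posdef A -> 0 <= quad_form A h.
Proof.
by move=> Apos; have [->|/Apos/ltW//] := eqVneq h 0; rewrite quad_form0.
Qed.

Lemma dotv_mulmx A h : dotv (A *m h) h = quad_form A h.
Proof.
rewrite /dotv /quad_form trmx_mul.
have -> : h^T *m A *m h = (h^T *m A^T *m h)^T by rewrite !trmx_mul !trmxK mulmxA.
by rewrite [RHS]mxE.
Qed.

End LinearAlgebra.

(** * One step of the regularized Newton method *)

Section RegularizedStep.
Context {R : realType} {n : nat}.
Variables (f F : 'cV[R]_n -> \bar R) (kappa : R).
Hypothesis f_ninfty : never_ninfty f.
Hypothesis F_ninfty : never_ninfty F.
Hypothesis F_convex : econvex F.
Hypothesis f_diff : forall x, dom f x -> differentiable (toR f) x.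
Hypothesis kappa_gt0 : 0 < kappa.
Hypothesis f_sc : based_self_concordant F kappa f.

Let g := esum_fun f F.
Let domg : dom g = dom f.
Proof. by have [fF _ _] := f_sc; apply: dom_esum. Qed.

(** The two sides differ by [F (x + h) - F x - 'D_h F x], which is nonnegative by
    convexity of [F]. *)
Lemma based_model_le x h : dom f x -> dom f (x + h) ->
  toR f (x + h) - toR f x - 'D_h (toR f) x <=
  toR g (x + h) - toR g x - 'D_h (toR g) x.
Proof.
have [fF [[ng cg] _ og [dg _] _] _] := f_sc => fx fxh.
have gx : dom g x by rewrite domg.
have seg s : 0 <= s <= 1 -> dom f (x + s *: h).
  by rewrite -domg; apply: dom_segment => //; rewrite ?scale1r domg.
pose p s := toR g (x + s *: h) - toR f (x + s *: h).
have pF s : 0 <= s <= 1 -> p s = toR F (x + s *: h).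
  move=> /seg fs; rewrite /p toR_esum //; last exact: fF.
  by rewrite addrAC subrr add0r.
have dp : is_derive (0 : R) 1 p ('D_h (toR g) x - 'D_h (toR f) x).
  have -> : x = x + 0 *: h by rewrite scale0r addr0.
  apply: is_deriveB; apply: is_derive_line; apply: diff_derivable;
    rewrite scale0r addr0; [exact: dg|exact: f_diff].
have p1E : p 1 = toR g (x + h) - toR f (x + h) by rewrite /p scale1r.
have p0E : p 0 = toR g x - toR f x by rewrite /p scale0r addr0.
suff : 'D_h (toR g) x - 'D_h (toR f) x <= p 1 - p 0 by rewrite p1E p0E; lra.
apply: (convex_derive_le dp) => s /andP[s0 s1].
have Fx : dom F x by exact: fF.
have F1 : dom F (x + h) by exact: fF.
rewrite !pF ?lexx ?ler01 ?(ltW s0) ?(ltW s1) // scale0r addr0 scale1r [leRHS]addrC.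
have [|_] := @econvex_toR _ _ F (x + h) x s F_ninfty F_convex F1 Fx.
  by rewrite s0.
suff -> : s *: (x + h) + (1 - s) *: x = x + s *: h by [].
by rewrite scalerDr scalerBl scale1r addrAC addrCA subrr addr0.
Qed.

Section AtPoint.
Variable x : 'cV[R]_n.
Hypothesis fx : dom f x.

Let H := hessian (toR g) x.
Let d := RNM_dir f F x.
Let l := RNM_lambda f F x.
Let t := RNM_step kappa f F x.

Let H_pos : posdef H.
Proof. by have [_ _] := f_sc; apply. Qed.

Lemma hessian_RNM_dir : gradient (toR f) x = - (H *m d).
Proof.
by rewrite /d /RNM_dir mulmxN opprK mulmxA mulmxV ?mul1mx // posdef_unitmx.
Qed.

Lemma dotv_gradient_RNM_dir : dotv (gradient (toR f) x) d = - quad_form H d.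
Proof.
by rewrite hessian_RNM_dir dotvNl dotv_mulmx.
Qed.

Lemma RNM_lambda_sqrt : l = Num.sqrt (quad_form H d).
Proof. by rewrite /l /RNM_lambda dotv_gradient_RNM_dir opprK. Qed.

Lemma RNM_lambda_sqr : l ^+ 2 = quad_form H d.
Proof. by rewrite RNM_lambda_sqrt sqr_sqrtr // posdef_quad_form_ge0. Qed.

Lemma RNM_lambda_ge0 : 0 <= l.
Proof. exact: sqrtr_ge0. Qed.

Let kl_gt0 : 0 < 1 + kappa * l.
Proof. by rewrite ltr_wpDr // mulr_ge0 ?RNM_lambda_ge0 // ltW. Qed.

Lemma RNM_step_gt0 : 0 < t.
Proof. by rewrite /t /RNM_step div1r invr_gt0. Qed.

Lemma RNM_step_le1 : t <= 1.
Proof.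
rewrite /t /RNM_step ler_pdivrMr // mul1r lerDl.
by rewrite mulr_ge0 ?RNM_lambda_ge0 // ltW.
Qed.

Lemma RNM_step_mul : t * (1 + kappa * l) = 1.
Proof. by rewrite /t /RNM_step divfK // gt_eqF. Qed.

Let gx : dom g x. Proof. by rewrite domg. Qed.

Let g_sc : self_concordant kappa g. Proof. by have [] := f_sc. Qed.

Let g_posdef y : dom g y -> posdef (hessian (toR g) y).
Proof. by rewrite domg; have [_ _] := f_sc; apply. Qed.

Let tl_le1 : t * (1 + kappa * Num.sqrt (quad_form H d)) <= 1.
Proof. by rewrite -RNM_lambda_sqrt RNM_step_mul. Qed.

Lemma RNM_step_dom : dom f (x + t *: d).
Proof.
rewrite -domg; apply: (self_concordant_step_dom kappa_gt0 g_sc g_posdef gx _ tl_le1).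
exact: ltW RNM_step_gt0.
Qed.

(** Since [t (1 + kappa l) = 1], the quadratic term of [self_concordant_upper] at
    [t] is exactly [l ^ 2 / 2], while the linear term of [f] is [- t l ^ 2]. *)
Lemma RNM_descent :
  toR f (x + t *: d) <= toR f x - l ^+ 2 * (t - 2^-1).
Proof.
have gt : dom g (x + t *: d) by rewrite domg; exact: RNM_step_dom.
have [[_ _] _ _ [dg _] _] := g_sc.
have up := self_concordant_upper kappa_gt0 g_sc g_posdef gx gt
  (ltW RNM_step_gt0) tl_le1.
have := based_model_le fx RNM_step_dom.
have DZ (p : 'cV[R]_n -> R) : differentiable p x -> 'D_(t *: d) p x = t * 'D_d p x.
  by move=> dp; rewrite !deriveE // linearZ.
rewrite (DZ _ (f_diff fx)) (DZ _ (dg _ gx)).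
move: up; rewrite -RNM_lambda_sqrt -RNM_lambda_sqr.
rewrite (derive_dotv _ (f_diff fx)) dotv_gradient_RNM_dir -RNM_lambda_sqr.
have -> : l ^+ 2 * (1 + kappa * l) ^+ 2 / 2 * t ^+ 2 =
    l ^+ 2 / 2 * (t * (1 + kappa * l)) ^+ 2 by ring.
by rewrite RNM_step_mul expr1n; lra.
Qed.

Variable alpha : R.
Hypothesis alpha_gt0 : 0 < alpha.
Hypothesis g_strong : strongly_convex alpha g.

Lemma RNM_dir_sqr_le : alpha * norm2 d ^+ 2 <= l ^+ 2.
Proof. by rewrite RNM_lambda_sqr; exact: (strongly_convex_hessian_ge g_sc d g_strong gx). Qed.

(** By Cauchy-Schwarz, [l ^ 2 = - grad f . d <= |grad f| |d|], and [|d|] is at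
    most [l / sqrt alpha]. *)
Lemma RNM_lambda_le_gradient :
  alpha * l ^+ 2 <= norm2 (gradient (toR f) x) ^+ 2.
Proof.
have := dotv_sqr_le (gradient (toR f) x) d.
rewrite dotv_gradient_RNM_dir -RNM_lambda_sqr sqrrN => cs.
have := RNM_dir_sqr_le; set L := l ^+ 2 in cs *; set N := norm2 d ^+ 2 in cs *.
set G := norm2 _ ^+ 2 in cs * => dl.
have L0 : 0 <= L by exact: sqr_ge0.
have [-> |Ln0] := eqVneq L 0; first by rewrite mulr0 sqr_ge0.
have Lp : 0 < L by rewrite lt_def Ln0.
have G0 : 0 <= G by exact: sqr_ge0.
have : alpha * L ^+ 2 <= G * L.
  apply: (@le_trans _ _ (alpha * (G * N))); first by rewrite ler_pM2l.
  by rewrite mulrCA ler_wpM2l.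
by rewrite expr2 mulrA ler_pM2r.
Qed.

(** The gradient is [- H d], so its norm is at most the Frobenius norm of [H]
    times [|d|]. *)
Lemma gradient_le_RNM_lambda :
  alpha * norm2 (gradient (toR f) x) ^+ 2 <= (\sum_i \sum_j H i j ^+ 2) * l ^+ 2.
Proof.
have S0 : 0 <= \sum_i \sum_j H i j ^+ 2.
  by apply: sumr_ge0 => i _; apply: sumr_ge0 => j _; exact: sqr_ge0.
apply: le_trans (ler_wpM2l S0 RNM_dir_sqr_le).
rewrite [leRHS]mulrCA ler_pM2l // hessian_RNM_dir -scaleN1r norm2Z_sqr sqrrN expr1n mul1r.
exact: norm2_mulmx_sqr_le.
Qed.

End AtPoint.
End RegularizedStep.

(** * Convergence of locally contracting sequences *)

(** With [s = sqrt q], the potential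
    [P j = |x - xs j| + C / (1 - s) * sqrt (Delta j)] does not increase at an
    iterate within distance [r] of [x]: the step moves the first term by at
    most [C sqrt (Delta j)], and the second one loses at least that much.  As [P] becomes
    arbitrarily small, it eventually stays below any given bound. *)
Lemma contracting_sequence_cvg (R : realType) (V : normedModType R)
    (xs : nat -> V) (x : V) (Delta : nat -> R) (q C r : R) :
  0 < q < 1 -> 0 <= C -> 0 < r -> (forall j, 0 <= Delta j) ->
  (forall j, `|x - xs j| < r -> Delta j.+1 <= q * Delta j /\
     `|xs j.+1 - xs j| <= C * Num.sqrt (Delta j)) ->
  (forall e, 0 < e -> exists k, `|x - xs k| < e /\ Delta k < e) ->
  xs @ \oo --> x /\
  exists K, forall j, (K <= j)%N -> Delta j.+1 <= q * Delta j.
Proof.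
move=> /andP[q0 q1] C0 r0 D0 contr sub.
set s := Num.sqrt q.
have s0 : 0 < s by rewrite sqrtr_gt0.
have s1 : s < 1 by rewrite -sqrtr1 ltr_sqrt.
have s1' : 0 < 1 - s by rewrite subr_gt0.
pose C' := C / (1 - s).
have C'0 : 0 <= C' by rewrite divr_ge0 // ltW.
have C'E : C = C' * (1 - s) by rewrite /C' divfK // gt_eqF.
pose P j := `|x - xs j| + C' * Num.sqrt (Delta j).
have distP j : `|x - xs j| <= P j.
  by rewrite /P lerDl mulr_ge0 // sqrtr_ge0.
have Pdecr j : P j < r -> P j.+1 <= P j.
  move=> Pr; have [Dq step] := contr j (le_lt_trans (distP j) Pr).
  have dist : `|x - xs j.+1| <= `|x - xs j| + C * Num.sqrt (Delta j).
    have -> : x - xs j.+1 = (x - xs j) - (xs j.+1 - xs j).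
      by rewrite opprB addrA subrK.
    by apply: le_trans (ler_normB _ _) _; rewrite lerD2l.
  have sD : Num.sqrt (Delta j.+1) <= s * Num.sqrt (Delta j).
    by rewrite -sqrtrM ?(ltW q0) // ler_wsqrtr.
  have := ler_wpM2l C'0 sD.
  by rewrite /P; move: dist; rewrite C'E; lra.
have Pstay e k : e <= r -> P k < e -> forall j, (k <= j)%N -> P j < e.
  move=> er Pk; elim=> [|j IH]; first by rewrite leqn0 => /eqP <-.
  rewrite leq_eqVlt => /predU1P[<- //|kj].
  have Pj := IH kj.
  exact: le_lt_trans (Pdecr _ (lt_le_trans Pj er)) Pj.
have Psmall e : 0 < e -> exists k, P k < e.
  move=> e0; pose a := e / 2 / (C' + 1).
  have C'1 : 0 < C' + 1 by rewrite ltr_wpDl.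
  have a0 : 0 < a by rewrite !divr_gt0.
  have m0 : 0 < Num.min (e / 2) (a ^+ 2) by rewrite lt_min divr_gt0 //= exprn_gt0.
  have [k] := sub _ m0; rewrite !lt_min => -[/andP[xk _] /andP[_ Dk]].
  exists k; rewrite /P.
  have sk : Num.sqrt (Delta k) < a.
    by rewrite -[ltRHS]gtr0_norm // -sqrtr_sqr ltr_sqrt // exprn_gt0.
  have ae : a * (C' + 1) = e / 2 by rewrite /a divfK // gt_eqF.
  have := ler_wpM2l C'0 (ltW sk).
  by have := ltW a0; move: xk ae; lra.
split.
  apply/cvgrPdist_lt => e e0.
  have m0 : 0 < Num.min e r by rewrite lt_min e0.
  have [k Pk] := Psmall _ m0.
  near=> j.
  have Pj : P j < Num.min e r.
    apply: Pstay Pk _ _; first by rewrite ge_min lexx orbT.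
    by near: j; exists k.
  apply: le_lt_trans (distP j) _; apply: lt_le_trans Pj _.
  by rewrite ge_min lexx.
have [K PK] := Psmall _ r0.
exists K => j Kj; have Pj := Pstay r K (lexx _) PK j Kj.
by have [] := contr j (le_lt_trans (distP j) Pj).
Unshelve. all: by end_near. Qed.

(** * Contraction near a minimizer *)

Lemma minimizer_gradient0 (R : realType) n (f : 'cV[R]_n -> \bar R) x :
  never_ninfty f -> minimizer f x -> nbhs x (dom f) ->
  (forall y, dom f y -> differentiable (toR f) y) ->
  gradient (toR f) x = 0.
Proof.
move=> nf fmin fx df; apply/colP => i; rewrite !mxE.
set h := delta_mx i 0.
have /nbhs_ballP[e /= e0 be] := near_line h fx.
have inD t : t \in `]- e, e[ -> dom f (x + t *: h).
  rewrite in_itv /= => te; apply: be.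
  by rewrite /ball /= sub0r normrN ltr_norml.
have D0 : 0 \in `](- e), e[ by rewrite in_itv /= oppr_lt0 e0.
have dline t : t \in `]- e, e[ ->
    is_derive t 1 (fun s => toR f (x + s *: h)) ('D_h (toR f) (x + t *: h)).
  by move=> /inD ft; apply: is_derive_line; apply/diff_derivable/df.
have e2 : - e <= e by rewrite ge0_cp // ltW.
have [|t te|_ ] := @derive1_at_min _ (fun s => toR f (x + s *: h)) (- e) e 0 e2 _ D0.
- by move=> t /dline[].
- have fxx : dom f x := nbhs_singleton fx.
  rewrite scale0r addr0; have := fmin (x + t *: h).
  by rewrite (toRK nf fxx) (toRK nf (inD _ te)) lee_fin.
have [_] := dline 0 D0; rewrite scale0r addr0 => -> <-.
by [].
Qed.

Lemma cvg_sum_ord (R : realType) (T : topologicalType) n (h : 'I_n -> T -> R)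
    (l : 'I_n -> R) (x : T) :
  (forall i, h i y @[y --> x] --> l i) ->
  \sum_i h i y @[y --> x] --> \sum_i l i.
Proof. by move=> hl; apply: cvg_big => [|i _]; [exact: add_continuous|exact: hl]. Qed.

Section LocalContraction.
Context {R : realType} {n : nat}.
Variables (f F : 'cV[R]_n -> \bar R) (kappa alpha mu : R).
Variables (xstar : 'cV[R]_n) (U : set 'cV[R]_n).
Hypothesis f_ninfty : never_ninfty f.
Hypothesis F_ninfty : never_ninfty F.
Hypothesis f_C3 : continuously_diff 3 (dom f) (toR f).
Hypothesis F_convex : econvex F.
Hypothesis kappa_gt0 : 0 < kappa.
Hypothesis f_sc : based_self_concordant F kappa f.
Hypothesis alpha_gt0 : 0 < alpha.
Hypothesis fF_strong : strongly_convex alpha (esum_fun f F).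
Hypothesis xstar_min : minimizer f xstar.
Hypothesis mu_gt0 : 0 < mu.
Hypothesis U_nbhs : nbhs xstar U.
Hypothesis U_dom : U `<=` dom f.
Hypothesis f_PL : PL_on mu f xstar U.

Let f_diff x : dom f x -> differentiable (toR f) x.
Proof. by have [df _] := f_C3; exact: df. Qed.

Let f_xstar : dom f xstar.
Proof. by apply: U_dom; exact: nbhs_singleton. Qed.

Let x_plus x := x + RNM_step kappa f F x *: RNM_dir f F x.

Lemma minimizer_toR_le x : dom f x -> toR f xstar <= toR f x.
Proof.
by move=> fx; rewrite -lee_fin -(toRK f_ninfty f_xstar) -(toRK f_ninfty fx).
Qed.

Lemma near_gradient_small (e : R) : 0 < e ->
  \forall x \near xstar, norm2 (gradient (toR f) x) ^+ 2 < e.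
Proof.
move=> e0; have [_ cdf] := f_C3.
have G0 : gradient (toR f) xstar = 0.
  apply: minimizer_gradient0 => //; exact: filterS U_nbhs.
have c i : {for xstar, continuous ('D_(delta_mx i 0) (toR f))}.
  apply: differentiable_continuous.
  by have [H _] := cdf (delta_mx i 0); apply: H.
have cG : \sum_i 'D_(delta_mx i 0) (toR f) x ^+ 2 @[x --> xstar] -->
    \sum_i 'D_(delta_mx i 0) (toR f) xstar ^+ 2.
  apply: cvg_sum_ord => i.
  by apply: (@cvgM _ _ _ _ _ _ _ _ (c i) (c i)).
have S0 : \sum_i 'D_(delta_mx i 0) (toR f) xstar ^+ 2 < e.
  rewrite big1 // => i _; have := congr1 (fun u : 'cV_n => u i 0) G0.
  by rewrite !mxE => ->; rewrite expr0n.
near=> x; rewrite norm2_sqr; under eq_bigr do rewrite mxE.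
near: x; exact: (cvgr_lt _ cG _ S0).
Unshelve. all: by end_near. Qed.

Lemma near_hessian_bounded : exists2 M : R, 0 < M & \forall x \near xstar,
  \sum_i \sum_j hessian (toR (esum_fun f F)) x i j ^+ 2 <= M.
Proof.
have [fF [_ _ _ [_ cdg] _] _] := f_sc.
have gx : dom (esum_fun f F) xstar by rewrite dom_esum.
set gR := toR _ in cdg *.
have c i j : {for xstar, continuous ('D_(delta_mx i 0) ('D_(delta_mx j 0) gR))}.
  apply: differentiable_continuous.
  by have [_ /(_ (delta_mx i 0))[H _]] := cdg (delta_mx j 0); apply: H.
pose S x := \sum_i \sum_j 'D_(delta_mx i 0) ('D_(delta_mx j 0) gR) x ^+ 2.
have cS : S x @[x --> xstar] --> S xstar.
  apply: cvg_sum_ord => i; apply: cvg_sum_ord => j.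
  by apply: (@cvgM _ _ _ _ _ _ _ _ (c i j) (c i j)).
have S0 : 0 <= S xstar.
  by apply: sumr_ge0 => i _; apply: sumr_ge0 => j _; exact: sqr_ge0.
exists (S xstar + 1); first by rewrite ltr_wpDl.
have SS : S xstar < S xstar + 1 by rewrite ltrDl.
near=> x; under eq_bigr do under eq_bigr do rewrite mxE.
by apply: ltW; near: x; exact: (cvgr_lt _ cS _ SS).
Unshelve. all: by end_near. Qed.

(** The bound [|grad f| ^ 2 < alpha / (4 kappa ^ 2)] forces [kappa l <= 1 / 2],
    hence [t - 1 / 2 >= 1 / 6] and a decrease of at least [l ^ 2 / 6].  If [M]
    bounds the squared Frobenius norm of the Hessian, the
    Polyak-Lojasiewicz inequality gives [2 mu alpha (f x - f xstar) <= M l ^ 2],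
    which yields the rate [1 - mu alpha / (3 M)]. *)
Lemma RNM_local_contraction : exists q C : R, [/\ 0 < q < 1, 0 <= C &
  \forall x \near xstar,
    toR f (x_plus x) - toR f xstar <= q * (toR f x - toR f xstar) /\
    `|x_plus x - x| <= C * Num.sqrt (toR f x - toR f xstar)].
Proof.
have [M M0 nearM] := near_hessian_bounded.
pose c := mu * alpha / (3 * M).
have c0 : 0 < c by rewrite divr_gt0 ?mulr_gt0.
(* The maximum keeps the rate positive, as [1 - c] may be negative. *)
exists (Num.max (1 - c) 2^-1), (Num.sqrt (6 / alpha)).
split; [|exact: sqrtr_ge0|].
  by rewrite lt_max gt_max invr_gt0 ltr0n orbT /= invf_lt1 ?ltr1n // andbT gtrBl.
pose e := alpha / (4 * kappa ^+ 2).
have k20 : 0 < kappa ^+ 2 by rewrite exprn_gt0.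
have e0 : 0 < e by rewrite divr_gt0 // mulr_gt0.
have := near_gradient_small e0.
apply: filter_app; apply: filter_app nearM; move: U_nbhs.
apply: filterS => x Ux HM Ge.
have fx := U_dom Ux.
set l := RNM_lambda f F x; set d := RNM_dir f F x; set t := RNM_step kappa f F x.
have lG := RNM_lambda_le_gradient f_ninfty F_ninfty f_sc fx alpha_gt0 fF_strong.
have Gl := gradient_le_RNM_lambda f_ninfty F_ninfty f_sc fx alpha_gt0 fF_strong.
have dl := RNM_dir_sqr_le f_ninfty F_ninfty f_sc fx fF_strong.
have desc := RNM_descent f_ninfty F_ninfty F_convex f_diff kappa_gt0 f_sc fx.
have fxp := RNM_step_dom f_ninfty F_ninfty kappa_gt0 f_sc fx.
have t0 := RNM_step_gt0 f F kappa_gt0 x.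
have t1 := RNM_step_le1 f F kappa_gt0 x.
have tl := RNM_step_mul f F kappa_gt0 x.
have l0 := RNM_lambda_ge0 f F x.
have PL := f_PL Ux.
rewrite -/l -/d -/t in lG Gl dl desc fxp t0 t1 tl l0 *.
have fp := minimizer_toR_le fxp; have f0 := minimizer_toR_le fx.
set G := norm2 (gradient _ x) ^+ 2 in lG Gl PL Ge.
have kl : kappa * l <= 2^-1.
  have : (kappa * l) ^+ 2 <= 2^-1 ^+ 2.
    rewrite exprMn -(ler_pM2l alpha_gt0).
    have -> : alpha * 2^-1 ^+ 2 = kappa ^+ 2 * e.
      by rewrite /e; field; rewrite gt_eqF.
    by rewrite mulrCA ler_pM2l // (le_trans lG) // ltW.
  by rewrite ler_pXn2r ?nnegrE ?mulr_ge0 // ?invr_ge0 // ltW.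
have t23 : 6^-1 <= t - 2^-1.
  have : t * (1 + kappa * l) <= t * (1 + 2^-1) by rewrite ler_wpM2l ?(ltW t0) // lerD2l.
  by rewrite tl; lra.
have l20 : 0 <= l ^+ 2 by exact: sqr_ge0.
have desc6 : toR f (x_plus x) <= toR f x - l ^+ 2 / 6.
  by have := ler_wpM2l l20 t23; move: desc; rewrite /x_plus -/t -/d; lra.
set Dx := toR f x - toR f xstar.
have Dx0 : 0 <= Dx by rewrite subr_ge0.
have l2D : c * Dx <= l ^+ 2 / 6.
  have : alpha * G <= M * l ^+ 2 by apply: le_trans Gl _; rewrite ler_wpM2r.
  have : alpha * (mu * Dx) <= alpha * (1 / 2 * G) by rewrite ler_pM2l.
  have -> : c * Dx = (alpha * (mu * Dx)) / (3 * M) by rewrite /c; field; rewrite gt_eqF.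
  by rewrite ler_pdivrMr ?mulr_gt0 //; lra.
split.
  apply: (@le_trans _ _ ((1 - c) * Dx)); first by rewrite /Dx in l2D *; lra.
  by rewrite ler_wpM2r // le_max lexx.
have -> : x_plus x - x = t *: d by rewrite /x_plus addrAC subrr add0r.
rewrite normrZ gtr0_norm //.
apply: (@le_trans _ _ (norm2 d)).
  apply: le_trans (normr_le_norm2 d).
  by rewrite ler_piMl.
rewrite -sqrtrM; last by rewrite divr_ge0 // ltW.
rewrite -[leLHS]ger0_norm ?sqrtr_ge0 // -sqrtr_sqr ler_wsqrtr //.
rewrite -(ler_pM2l alpha_gt0) (le_trans dl) //.
have -> : alpha * (6 / alpha * Dx) = 6 * Dx by field; rewrite gt_eqF.
by rewrite /Dx; move: desc6 fp; rewrite /x_plus -/t -/d; lra.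
Qed.

End LocalContraction.

(** * Convergence of the regularized Newton method *)

Theorem theorem3p3 (R : realType) (n : nat)
    (f F : 'cV[R]_n -> \bar R) (kappa alpha mu : R)
    (xstar : 'cV[R]_n) (U : set 'cV[R]_n) (xs : nat -> 'cV[R]_n)
    (f_ninfty : never_ninfty f) (F_ninfty : never_ninfty F)
    (f_C3 : continuously_diff 3 (dom f) (toR f))
    (f_bounded : bounded_below f)
    (F_convex : econvex F)
    (kappa_gt0 : 0 < kappa)
    (f_sc : based_self_concordant F kappa f)
    (alpha_gt0 : 0 < alpha)
    (fF_strong : strongly_convex alpha (esum_fun f F))
    (xstar_min : minimizer f xstar)
    (mu_gt0 : 0 < mu)
    (U_nbhs : nbhs xstar U) (U_dom : U `<=` dom f)
    (f_PL : PL_on mu f xstar U)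
    (xs_RNM : RNM_sequence kappa f F xs)
    (xstar_lim : limit_of_subseq xs xstar) :
  xs @ \oo --> xstar /\
  Q_linear_to0 (fun j => toR f (xs j) - toR f xstar).
Proof.
have [fx0 xsS] := xs_RNM.
have fxs j : dom f (xs j).
  elim: j => // j fxj; rewrite xsS.
  exact: (RNM_step_dom f_ninfty F_ninfty kappa_gt0 f_sc fxj).
have f_xstar : dom f xstar by apply: U_dom; exact: nbhs_singleton.
have D0 j : 0 <= toR f (xs j) - toR f xstar.
  by rewrite subr_ge0; exact: (minimizer_toR_le f_ninfty xstar_min U_nbhs U_dom).
have [q [C [q01 C0 /nbhs_ballP[r /= r0 br]]]] :=
  RNM_local_contraction f_ninfty F_ninfty f_C3 F_convex kappa_gt0 f_sc alpha_gt0
    fF_strong xstar_min mu_gt0 U_nbhs U_dom f_PL.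
have [j xjr|e e0|xs_cvg [K Q]] :=
    @contracting_sequence_cvg _ _ xs xstar
      (fun j => toR f (xs j) - toR f xstar) q C r q01 C0 r0 D0.
- by rewrite xsS; apply: br; rewrite -ball_normE.
- have [phi phi_incr phi_cvg] := xstar_lim.
  have f_cont : {for xstar, continuous (toR f)}.
    by apply: differentiable_continuous; have [df _] := f_C3; exact: df.
  have fphi : (toR f (xs (phi i))) @[i --> \oo] --> toR f xstar.
    exact: (cvg_comp _ _ phi_cvg f_cont).
  near \oo => i; exists (phi i); split.
    by near: i; move/cvgrPdist_lt: phi_cvg; apply.
  rewrite ltrBlDl; near: i; apply: (cvgr_lt _ fphi).
  by rewrite ltrDl.
by split => //; split => //; exists q, K.
Unshelve. all: by end_near. Qed.
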